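(* Let $L\ge 1$ be an integer and $N=4L+1$. (i) For $-L\le n\le L$ define $\mathbf u_n\in\mathbb R^N$ by $$u_n(k):=S(3L+n+k)\,S(3L+n-k),\qquad k\in I_N.$$ Then, up to multiplication by nonzero real constants, the nonzero even vectors $\mathbf u\in\mathbb R^N$ satisfying $\ell(\mathbf u)+\ell(\mathcal F\mathbf u)=N+1$ are exactly the vectors $\{\mathbf u_n\}_{-L\le n\le L}$. The vectors $\{\mathbf u_n\}_{-L\le n\le L}$ are linearly independent and satisfy $$\mathcal F\mathbf u_n=N^{-1/2}S(2L+2n)\,\mathbf u_{-n},\qquad -L\le n\le L.$$ (ii) For $-L\le n\le L-1$ define $\mathbf v_n\in\mathbb R^N$ by $$v_n(k):=\sin(2\pi k/N)\,S(3L+n+k)\,S(3L+n-k),\qquad k\in I_N.$$ Then, up to multiplication by nonzero real constants, the nonzero odd vectors $\mathbf v\in\mathbb R^N$ satisfying $\ell(\mathbf v)+\ell(\mathcal F\mathbf v)\le N+3$ are exactly the vectors $\{\mathbf v_n\}_{-L\le n\le L-1}$. The vectors $\{\mathbf v_n\}_{-L\le n\le L-1}$ are linearly independent and satisfy $$\mathcal F\mathbf v_n=-\mathrm i N^{-1/2}S(2L+2n+1)\,\mathbf v_{-n-1},\qquad -L\le n\le L-1.$$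
   Context: For $N=4L+1$, vectors in $\mathbb C^N$ (and $\mathbb R^N$) are indexed by $I_N=\{-2L,-2L+1,\dots,2L\}$; the entry of $\mathbf u$ at index $k$ is written $u(k)$. The (centered) discrete Fourier transform $\mathcal F:\mathbb C^N\to\mathbb C^N$ is $$(\mathcal F\mathbf u)(j)=\frac1{\sqrt N}\sum_{k\in I_N}e^{-2\pi \mathrm i kj/N}u(k),\qquad j\in I_N.$$ The sequence $S(k)$, $k\ge 0$ (depending on $N$), is defined by $S(0)=1$ and $S(k)=\prod_{j=1}^k 2\sin(\pi j/N)$ for $k\ge1$ (so $S(k)=0$ for $k\ge N$). A vector $\mathbf a\in\mathbb R^N$ is even (respectively odd) if $a(k)=a(-k)$ (respectively $a(k)=-a(-k)$) for all $k\in I_N$. For a nonzero vector $\mathbf b\in\mathbb C^N$, $\mathrm{supp}(\mathbf b)=\{k\in I_N:b(k)\neq0\}$ and the length of $\mathbf b$ is $\ell(\mathbf b)=1+\max\{i-j: i,j\in\mathrm{supp}(\mathbf b)\}$. *)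

(* Defs.v *)
From HB Require Import structures.
From mathcomp Require Export all_boot all_order all_algebra.
From mathcomp Require Export complex.
From mathcomp Require Export reals trigo.

Set Implicit Arguments.
Unset Strict Implicit.
Unset Printing Implicit Defensive.

Import Order.TTheory GRing.Theory Num.Theory.

Local Open Scope ring_scope.
Local Open Scope complex_scope.

Definition npts (L : nat) : nat := (4 * L).+1.

(* Vectors indexed by {-2L, ..., 2L} are column vectors of size npts L; the
   position i : 'I_(npts L) stands for the index ctr i. *)
Definition ctr (L : nat) (i : 'I_(npts L)) : int := i%:Z - (2 * L)%:Z.

(* The negation of centered indices is rev_ord. *)
Lemma ctr_rev_ord (L : nat) (i : 'I_(npts L)) : ctr (rev_ord i) = - ctr i.
Proof.
rewrite /ctr /= /npts subSS -subzn; last by rewrite -ltnS ltn_ord.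
rewrite opprB addrAC; congr (_ - _).
by rewrite subzn ?leq_mul2r ?orbT // -mulnBl.
Qed.

Section Defs.
Variable R : realType.

(* expi t is the complex exponential e^(i t). *)
Definition expi (t : R) : R[i] := cos t +i* sin t.

Definition dft (L : nat) (u : 'cV[R[i]]_(npts L)) : 'cV[R[i]]_(npts L) :=
  \col_j (((Num.sqrt (npts L)%:R)^-1)%:C *
    \sum_k expi (- (2 * pi * (ctr k * ctr j)%:~R / (npts L)%:R)) * u k 0).

Definition Ssin (L k : nat) : R :=
  \prod_(1 <= j < k.+1) (2 * sin (pi * j%:R / (npts L)%:R)).

Definition even_vec (L : nat) (a : 'cV[R]_(npts L)) : Prop :=
  forall k, a k 0 = a (rev_ord k) 0.

Definition odd_vec (L : nat) (a : 'cV[R]_(npts L)) : Prop :=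
  forall k, a k 0 = - a (rev_ord k) 0.

Definition supp (L : nat) (b : 'cV[R[i]]_(npts L)) : {set 'I_(npts L)} :=
  [set k | b k 0 != 0].

(* Differences of positions are differences of centered indices. The truncated
   subtraction does not affect the maximum, which is at least i - i = 0 as soon
   as b is nonzero; ell 0 = 1 is a junk value. *)
Definition ell (L : nat) (b : 'cV[R[i]]_(npts L)) : nat :=
  (1 + \max_(i in supp b) \max_(j in supp b) (i - j))%N.

Definition cplx (L : nat) (u : 'cV[R]_(npts L)) : 'cV[R[i]]_(npts L) :=
  map_mx (real_complex R) u.

(* For -L <= n <= L the arguments of Ssin below are nonnegative, so that absz is
   just the cast from int to nat. *)
Definition uvec (L : nat) (n : int) : 'cV[R]_(npts L) :=
  \col_k (Ssin L (absz ((3 * L)%:Z + n + ctr k)%R) *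
          Ssin L (absz ((3 * L)%:Z + n - ctr k)%R)).

Definition vvec (L : nat) (n : int) : 'cV[R]_(npts L) :=
  \col_k (sin (2 * pi * (ctr k)%:~R / (npts L)%:R) *
          Ssin L (absz ((3 * L)%:Z + n + ctr k)%R) *
          Ssin L (absz ((3 * L)%:Z + n - ctr k)%R)).

End Defs.

Arguments Ssin : clear implicits.
Arguments uvec : clear implicits.
Arguments vvec : clear implicits.

(* Main.v *)
Require Import Defs.
From mathcomp Require Import all_boot all_order all_algebra.
From mathcomp Require Import complex reals trigo.
From mathcomp Require Import ring lra zify.

(** Write w = e^(2 pi i / N). Up to a power of w and the factor N^(-1/2), the
    transform of f at j is the value at w^(-j) of the generating polynomial
    [gpoly f], whose coefficients are the entries of f. So zeros of the
    transform are roots of a polynomial, and the support of f bounds its degree.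

    Even case. The support of f and that of its transform are symmetric, hence
    of lengths 2a+1 and 2b+1 when a and b are their largest indices, and the
    hypothesis reads a + b = 2L. Once a power of X is divided out, [gpoly f] has
    degree at most 2a and vanishes at the 2(2L-b) = 2a roots of unity w^m with
    b < |m| <= 2L. It is therefore a multiple of the product [cospoly a] of the
    quadratic factors (X - w^m)(X - w^-m), the multiple being f(a)
    ([extremal_even_poly]). This gives uniqueness up to scaling, and evaluating
    the product gives the transform: f(a) times the product [cosprod a] of the
    numbers 2 cos(2 pi j/N) - 2 cos(2 pi m/N) ([extremal_even_dft]).

    Odd case. Now a + b <= 2L+1, and two roots of unity are missing from the
    count. Oddness supplies a zero of the transform at 0, and it makes the
    extreme coefficients of [gpoly f] opposite, so that subtracting the right
    multiple of (X^2 - 1) [cospoly (a-1)] kills both of them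
    ([extremal_odd_poly]). The factor X^2 - 1 becomes the sine.

    Existence. Each difference of cosines is a product of two chords
    2 sin(pi x/N), and the reflection x -> N - x turns the value of
    [cosprod (L+n)] at k into S(3L+n+k) S(3L+n-k) / S(4L) ([Ssin_cosprod]); so
    u_n is S(4L) times [cosprod (L+n)]. By its definition [cosprod (L+n)] vanishes for
    |k| > L-n, and as a trigonometric polynomial of degree L+n it has a
    transform supported in |j| <= L+n, by orthogonality of the characters
    ([band_dft]). The vector u_n thus satisfies the hypotheses of the uniqueness
    part, which then computes its transform; the constant is its entry at
    index L-n, namely S(4L) S(2L+2n), whose factor S(4L) turns [cosprod (L-n)]
    into u_(-n). The vectors v_n are treated in the same way. Independence holds because the last indices of the supports are
    distinct ([free_triangular]). *)

Set Implicit Arguments.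
Unset Strict Implicit.
Unset Printing Implicit Defensive.

Import Order.TTheory GRing.Theory Num.Theory.
Local Open Scope ring_scope.
Local Open Scope complex_scope.

(** * Counting roots *)

Section Polynomials.
Variable F : fieldType.

(** After division by the power X^c, which does not affect nonzero roots, the
    degree is less than n. *)
Lemma window_poly_eq0 (p : {poly F}) (c n : nat) (rs : seq F) :
    (forall i, (i < c)%N -> p`_i = 0) ->
    (forall i, (c + n <= i)%N -> p`_i = 0) ->
    uniq rs -> (n <= size rs)%N -> 0 \notin rs -> all (root p) rs -> p = 0.
Proof.
move=> p_lo p_hi rs_uniq le_n_rs rs_neq0 p_rs.
have pE : p = drop_poly c p * 'X^c.
  rewrite -{1}(poly_take_drop c p); suff -> : take_poly c p = 0 by rewrite add0r.
  by apply/polyP=> i; rewrite coef_take_poly coef0; case: ifP => // /p_lo.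
suff -> : p = 0 by [].
rewrite pE (_ : drop_poly c p = 0) ?mul0r //.
apply: (roots_geq_poly_eq0 _ rs_uniq); last first.
  rewrite size_drop_poly leq_subLR; apply: (@leq_trans (c + n)).
    exact/leq_sizeP.
  by rewrite leq_add2l.
apply/allP=> x x_rs; have := allP p_rs x x_rs.
rewrite {1}pE !rootE hornerM hornerXn mulf_eq0 expf_eq0 => /orP[//|/andP[_ /eqP x0]].
by rewrite -x0 x_rs in rs_neq0.
Qed.

End Polynomials.

(** * Roots of unity *)

Section Trigonometry.
Variables (R : realType) (L : nat).

Definition ang (x : int) : R := 2 * pi * x%:~R / (npts L)%:R.

Lemma npts_neq0 : (npts L)%:R != 0 :> R.
Proof. by rewrite pnatr_eq0. Qed.

Lemma angD x y : ang (x + y) = ang x + ang y.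
Proof. by rewrite /ang intrD [X in X / _]mulrDr [LHS]mulrDl. Qed.

Lemma angN x : ang (- x) = - ang x.
Proof. by rewrite /ang mulrNz mulrN mulNr. Qed.

Lemma ang_npts : ang (npts L)%:Z = pi *+ 2.
Proof. by rewrite /ang -mulrA -pmulrn divff ?npts_neq0 // mulr1 mulr_natl. Qed.

Lemma ang_half x : ang x = (pi * x%:~R / (npts L)%:R) *+ 2.
Proof. by rewrite /ang -[RHS]mulr_natl !mulrA. Qed.

Definition omega : R[i] := expi (ang 1).

Lemma expiD (s t : R) : expi (s + t) = expi s * expi t.
Proof. by rewrite /expi cosD sinD [sin s * _ + _]addrC. Qed.

Lemma expi0 : expi (0 : R) = 1.
Proof. by rewrite /expi cos0 sin0. Qed.

Lemma expi_neq0 (t : R) : expi t != 0.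
Proof.
apply/eqP=> t0; have := expiD t (- t); rewrite subrr expi0 t0 mul0r.
by move/eqP; rewrite oner_eq0.
Qed.

Lemma expiN (t : R) : expi (- t) = (expi t)^-1.
Proof.
apply: (mulfI (expi_neq0 t)); rewrite -expiD subrr expi0 divff //.
exact: expi_neq0.
Qed.

Lemma omega_neq0 : omega != 0. Proof. exact: expi_neq0. Qed.

Lemma expi_ang (x : int) : expi (ang x) = omega ^ x.
Proof.
have nat_case (n : nat) : expi (ang n%:Z) = omega ^ n%:Z.
  elim: n => [|n IHn]; first by rewrite /ang mulr0 mul0r expi0.
  by rewrite exprSz -IHn -expiD -angD -intS.
case: x => // n; rewrite NegzE angN expiN nat_case.
by rewrite invr_expz.
Qed.

Lemma omegaE (x : int) : omega ^ x = cos (ang x) +i* sin (ang x).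
Proof. by rewrite -expi_ang. Qed.

Lemma omegaD (x y : int) : omega ^ (x + y) = omega ^ x * omega ^ y.
Proof. by rewrite expfzDr ?omega_neq0. Qed.

Lemma omega_npts : omega ^ (npts L)%:Z = 1.
Proof. by rewrite -expi_ang ang_npts /expi cos2pi sin2pi. Qed.

Lemma sin_pi_gt0 (x : int) : 0 < x < (npts L)%:Z ->
  0 < sin (pi * x%:~R / (npts L)%:R : R).
Proof.
case/andP=> x_gt0 x_lt; apply: sin_gt0_pi.
have N0 : 0 < (npts L)%:R :> R by rewrite ltr0n.
rewrite divr_gt0 ?mulr_gt0 ?pi_gt0 ?ltr0z //=.
by rewrite ltr_pdivrMr // ltr_pM2l ?pi_gt0 // pmulrn ltr_int.
Qed.

(** If w^x = 1 then cos(2t) = 1 - 2 sin(t)^2 = 1 for t = pi x/N; but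
    sin(t) > 0 when 0 < x < N. *)
Lemma omega_neq1 (x : int) : x != 0 -> `|x| < (npts L)%:Z -> omega ^ x != 1.
Proof.
have pos_case y : 0 < y < (npts L)%:Z -> omega ^ y != 1.
  move=> y_bd; rewrite omegaE eq_complex /= ang_half; apply/negP=> /andP[/eqP + _].
  have := sin_pi_gt0 y_bd; set t := _ / _ => t0.
  rewrite mulr2n cosD -!expr2 cos2sin2.
  move=> /eqP; rewrite -subr_eq0 (_ : _ - _ = - (sin t ^+ 2) *+ 2).
    by rewrite mulrn_eq0 /= oppr_eq0 expf_eq0 /= gt_eqF.
  ring.
move=> x0 x_lt; have [x_gt0|x_le0] := ltP 0 x.
  by apply: pos_case; move: x_lt; rewrite gtr0_norm // x_gt0.
rewrite -(opprK x) -invr_expz invr_eq1; apply: pos_case.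
by move: x_lt; rewrite ler0_norm // => ->; rewrite andbT; lia.
Qed.

Lemma omega_inj (m n : nat) : (m < npts L)%N -> (n < npts L)%N ->
  omega ^+ m = omega ^+ n -> m = n.
Proof.
move=> m_lt n_lt e; apply/eqP; apply: contraT => mn.
have : omega ^ (m%:Z - n%:Z) != 1 by apply: omega_neq1; lia.
by rewrite omegaD -invr_expz -!exprnP e divff ?eqxx // expf_neq0 ?omega_neq0.
Qed.

(** Orthogonality of the characters of Z/N: a geometric sum with ratio w^e,
    which is a nontrivial N-th root of unity. *)
Lemma sum_omega (e : int) : e != 0 -> `|e| < (npts L)%:Z ->
  \sum_(k < npts L) omega ^ (e * ctr k) = 0.
Proof.
move=> e0 e_lt.
transitivity (omega ^ (- (e * (2 * L)%:Z)) * \sum_(k < npts L) (omega ^ e) ^+ k).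
  rewrite big_distrr; apply: eq_bigr => k _ /=.
  by rewrite exprnP exprz_exp -omegaD /ctr mulrBr addrC.
have w1 : omega ^ e - 1 != 0 by rewrite subr_eq0 omega_neq1.
suff -> : \sum_(k < npts L) (omega ^ e) ^+ k = 0 by rewrite mulr0.
apply: (mulfI w1); rewrite -subrX1 mulr0 exprnP exprz_exp mulrC -exprz_exp.
by rewrite omega_npts exp1rz subrr.
Qed.

End Trigonometry.

(** * Extremal polynomials *)

Section CosineProduct.
Variables (R : realType) (L : nat).
Implicit Types (x : int) (d m n : nat).
Local Notation ang := (ang R L).
Local Notation omega := (omega R L).

Lemma cos_omega x : omega ^ x + omega ^ (- x) = (2 * cos (ang x))%:C.
Proof.
rewrite !omegaE angN cosN sinN.
by apply/eqP; rewrite eq_complex /= subrr mulr_natl mulr2n !eqxx.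
Qed.

(** The zeros of [cosprod d] among the indices, and the exponents of the roots of
    [cospoly d] as powers of w, are the 2d indices farthest from 0, namely +m and
    -m for 2L-d < m <= 2L. Counting them from 2L downwards lets [big_ord_recr]
    add one pair at a time. *)
Definition cosprod d x : R :=
  \prod_(i < d) (2 * cos (ang x) - 2 * cos (ang ((2 * L)%:Z - i%:Z))).

Definition cospoly d : {poly R[i]} :=
  \prod_(i < d) ('X^2 - (2 * cos (ang ((2 * L)%:Z - i%:Z)))%:C *: 'X + 1).

Lemma cosprodN d x : cosprod d (- x) = cosprod d x.
Proof. by rewrite /cosprod angN cosN. Qed.

Lemma cosprod_eq0 d x : ((2 * L)%:Z - d%:Z < `|x| <= (2 * L)%:Z + d%:Z) ->
  (d <= 2 * L)%N -> cosprod d x = 0.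
Proof.
move=> + le_d.
wlog x_ge0 : x / 0 <= x => [IH|].
  have [/IH //|x_lt0] := lerP 0 x.
  by rewrite -normrN -cosprodN => x_bd; apply: IH => //; lia.
rewrite ger0_norm // => x_bd.
have zero_at (i : nat) : (i < d)%N -> cos (ang x) = cos (ang ((2 * L)%:Z - i%:Z)) ->
    cosprod d x = 0.
  by move=> lt_i e; rewrite /cosprod (bigD1 (Ordinal lt_i)) //= e subrr mul0r.
have [x_le|x_gt] := lerP x (2 * L)%:Z.
  apply: (zero_at (absz ((2 * L)%:Z - x)%R)); first lia.
  by congr (cos (ang _)); lia.
have lt_d : (absz (x - (2 * L)%:Z - 1)%R < d)%N by lia.
apply: (zero_at _ lt_d).
(* For x > 2L the vanishing factor is the one of the index -x + N. *)
rewrite (_ : _ - _ = - x + (npts L)%:Z); last by rewrite /npts; lia.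
by rewrite angD ang_npts cosD2pi angN cosN.
Qed.

Lemma cosfactor_monic (c : R[i]) : 'X^2 - c *: 'X + 1 \is monic.
Proof.
rewrite -addrA monicE lead_coefDl ?lead_coefXn // size_polyXn.
rewrite (leq_ltn_trans (size_polyD _ _)) // size_polyN gtn_max size_poly1 andbT.
by rewrite (leq_ltn_trans (size_scale_leq _ _)) // size_polyX.
Qed.

Lemma size_cosfactor (c : R[i]) : size ('X^2 - c *: 'X + 1) = 3.
Proof.
rewrite -addrA size_polyDl ?size_polyXn //.
rewrite (leq_ltn_trans (size_polyD _ _)) // size_polyN gtn_max size_poly1 andbT.
by rewrite (leq_ltn_trans (size_scale_leq _ _)) // size_polyX.
Qed.

Lemma cospoly_monic d : cospoly d \is monic.
Proof. by apply: monic_prod => i _; apply: cosfactor_monic. Qed.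

Lemma size_cospoly d : size (cospoly d) = (2 * d).+1.
Proof.
elim: d => [|d IHd]; first by rewrite /cospoly big_ord0 size_poly1.
rewrite /cospoly big_ord_recr /= size_Mmonic ?cosfactor_monic //; last first.
  by rewrite monic_neq0 ?cospoly_monic.
by rewrite -/(cospoly d) IHd size_cosfactor; lia.
Qed.

Lemma cospoly_coef0 d : (cospoly d)`_0 = 1.
Proof.
rewrite -horner_coef0 /cospoly horner_prod big1 // => i _.
by rewrite !hornerE expr0n /= subr0 add0r.
Qed.

(** For z = w^x, each factor z^2 - 2c z + 1 is z (z + 1/z - 2c), and
    z + 1/z = 2 cos(2 pi x/N). *)
Lemma horner_cospoly d x :
  (cospoly d).[omega ^ x] = omega ^ (x * d%:Z) * (cosprod d x)%:C.
Proof.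
elim: d => [|d IHd].
  by rewrite /cospoly /cosprod !big_ord0 hornerE mulr0 mulr1.
rewrite /cospoly /cosprod !big_ord_recr /= hornerM -/(cospoly d) -/(cosprod d x) IHd.
rewrite !hornerE [in RHS]rmorphM [in RHS]rmorphB /= -(cos_omega x).
move: (2 * cos (ang _))%:C => c.
have -> : x * d.+1%:Z = x + x * d%:Z by rewrite intS mulrDr mulr1.
rewrite omegaD -(invr_expz _ x).
have := expfz_neq0 x (omega_neq0 R L).
by move: (omega ^ x) => z z0; field.
Qed.

Lemma horner_cospoly_eq0 d m : (d <= 2 * L)%N ->
  (2 * L - d < m <= 2 * L + d)%N -> (cospoly d).[omega ^+ m] = 0.
Proof.
move=> le_d m_bd; rewrite exprnP horner_cospoly cosprod_eq0 ?mulr0 //.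
lia.
Qed.

(** The difference of the two sides has no coefficient left at 2L+a, because
    [cospoly a] is monic. This leaves a window of 2a coefficients for the 2a
    given roots. *)
Lemma extremal_even_poly (p : {poly R[i]}) a : (a <= 2 * L)%N ->
    (forall i, (i < 2 * L - a)%N -> p`_i = 0) ->
    (forall i, (2 * L + a < i)%N -> p`_i = 0) ->
    (forall m, (2 * L - a < m <= 2 * L + a)%N -> p.[omega ^+ m] = 0) ->
  p = p`_(2 * L + a) *: ('X^(2 * L - a) * cospoly a).
Proof.
move=> le_a p_lo p_hi p_root; apply/eqP; rewrite -subr_eq0; apply/eqP.
set top := p`_(2 * L + a).
apply: (@window_poly_eq0 _ _ (2 * L - a) (2 * a)
  [seq omega ^+ m | m <- iota (2 * L - a).+1 (2 * a)]).
- by move=> i lt_i; rewrite coefB p_lo // coefZ coefXnM lt_i mulr0 subr0.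
- move=> i le_i; rewrite coefB coefZ coefXnM ifF; last lia.
  have [ei|ni] := eqVneq i (2 * L + a)%N.
    have -> : (cospoly a)`_(i - (2 * L - a)) = 1.
      rewrite (_ : (i - _)%N = (size (cospoly a)).-1).
        exact: (monicP (cospoly_monic a)).
      by rewrite size_cospoly; lia.
    by rewrite mulr1 ei subrr.
  rewrite p_hi ?[(cospoly a)`_ _]nth_default ?size_cospoly ?mulr0 ?subr0 //; lia.
- rewrite map_inj_in_uniq ?iota_uniq // => m n.
  rewrite !mem_iota => m_in n_in; apply: omega_inj; rewrite /npts; lia.
- by rewrite size_map size_iota.
- apply/mapP=> -[m _ /esym/eqP].
  by rewrite expf_eq0 (negPf (omega_neq0 _ _)) andbF.
- apply/allP=> _ /mapP[m + ->]; rewrite mem_iota => m_in.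
  rewrite rootE hornerD hornerN hornerZ hornerM horner_cospoly_eq0 //; last lia.
  by rewrite !mulr0 subr0 p_root //; lia.
Qed.

(** There are 2e+1 given roots for the 2e+3 coefficients from 2L-e-1 to 2L+e+1.
    The difference of the two sides loses both end coefficients: (X^2 - 1)
    [cospoly e] is monic with constant coefficient -1, which matches the
    antisymmetry of p. *)
Lemma extremal_odd_poly (p : {poly R[i]}) e : (e < 2 * L)%N ->
    (forall i, (i < 2 * L - e.+1)%N -> p`_i = 0) ->
    (forall i, (2 * L + e.+1 < i)%N -> p`_i = 0) ->
    p`_(2 * L - e.+1) = - p`_(2 * L + e.+1) -> p.[1] = 0 ->
    (forall m, (2 * L - e < m <= 2 * L + e)%N -> p.[omega ^+ m] = 0) ->
  p = p`_(2 * L + e.+1) *: ('X^(2 * L - e.+1) * (('X^2 - 1) * cospoly e)).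
Proof.
move=> lt_e p_lo p_hi p_anti p1 p_root; apply/eqP; rewrite -subr_eq0; apply/eqP.
set top := p`_(2 * L + e.+1).
have X2m : 'X^2 - 1 \is @monic R[i] by rewrite monicXnsubC.
have sz : size (('X^2 - 1) * cospoly e) = (2 * e).+3.
  rewrite size_Mmonic ?cospoly_monic ?monic_neq0 //.
  by rewrite size_cospoly size_XnsubC //; lia.
apply: (@window_poly_eq0 _ _ (2 * L - e) (2 * e).+1
  (1 :: [seq omega ^+ m | m <- iota (2 * L - e).+1 (2 * e)])).
- move=> i lt_i; rewrite coefB coefZ coefXnM.
  have [lt_i'|ge_i] := ltnP i (2 * L - e.+1); first by rewrite p_lo // mulr0 subr0.
  have -> : i = (2 * L - e.+1)%N by lia.
  rewrite p_anti subnn -horner_coef0 hornerM [(cospoly e).[0]]horner_coef0 cospoly_coef0.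
  by rewrite !hornerE expr0n /= -/top; ring.
- move=> i le_i; rewrite coefB coefZ coefXnM ifF; last lia.
  have [ei|ni] := eqVneq i (2 * L + e.+1)%N.
    have -> : (('X^2 - 1) * cospoly e)`_(i - (2 * L - e.+1)) = 1.
      rewrite (_ : (i - _)%N = (size (('X^2 - 1) * cospoly e)).-1).
        by apply/monicP; rewrite monicMl // cospoly_monic.
      by rewrite sz; lia.
    by rewrite mulr1 ei subrr.
  have p_i0 : p`_i = 0 by apply: p_hi; lia.
  by rewrite p_i0 nth_default ?sz ?mulr0 ?subr0 //; lia.
- rewrite /= map_inj_in_uniq ?iota_uniq ?andbT => [|m n].
    apply/mapP=> -[m + /esym e1]; rewrite mem_iota => m_in.
    have /omega_inj : omega ^+ m = omega ^+ 0 by rewrite e1.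
    rewrite /npts; lia.
  rewrite !mem_iota => m_in n_in; apply: omega_inj; rewrite /npts; lia.
- by rewrite /= size_map size_iota.
- rewrite inE eq_sym oner_eq0 /=; apply/mapP=> -[m _ /esym/eqP].
  by rewrite expf_eq0 (negPf (omega_neq0 _ _)) andbF.
- apply/andP; split.
    have X1 : ('X^2 - 1 : {poly R[i]}).[1] = 0 by rewrite !hornerE expr1n subrr.
    by rewrite rootE hornerD hornerN hornerZ !hornerM p1 X1 mul0r !mulr0 subrr.
  apply/allP=> _ /mapP[m + ->]; rewrite mem_iota => m_in.
  rewrite rootE hornerD hornerN hornerZ !hornerM horner_cospoly_eq0; try lia.
  by rewrite !mulr0 subr0 p_root //; lia.
Qed.

End CosineProduct.

(** * The products S(k) *)

Section SineProducts.
Variables (R : realType) (L : nat).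
Implicit Types (x : int) (d m n k : nat).

(** Length of the chord between 1 and w^x on the unit circle, up to sign. *)
Definition chord x : R := 2 * sin (pi * x%:~R / (npts L)%:R).

Lemma SsinS k : Ssin R L k.+1 = Ssin R L k * chord k.+1.
Proof. by rewrite /Ssin big_nat_recr. Qed.

Lemma chord_reflect x : chord ((npts L)%:Z - x) = chord x.
Proof.
rewrite /chord rmorphB /= mulrBr mulrBl -pmulrn mulfK ?npts_neq0 //.
by rewrite addrC sinDpi sinN opprK.
Qed.

Lemma chordM (m x : int) :
  chord (m - x) * chord (m + x) = 2 * cos (ang R L x) - 2 * cos (ang R L m).
Proof.
rewrite /chord !ang_half rmorphB rmorphD /=.
rewrite [pi * (_ - _)]mulrBr [pi * (_ + _)]mulrDr ![(_ + _) / _]mulrDl mulNr.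
move: (pi * m%:~R / _) (pi * x%:~R / _) => s t.
rewrite !mulr2n !sinD !cosD sinN cosN.
have hs := cos2Dsin2 s; have ht := cos2Dsin2 t.
move: (cos s) (sin s) (cos t) (sin t) hs ht => a b c d hs ht.
have -> : a * a = 1 - b * b by rewrite -hs; ring.
have -> : c * c = 1 - d * d by rewrite -ht; ring.
transitivity (4 * (b ^+ 2 * c ^+ 2 - a ^+ 2 * d ^+ 2)); first by ring.
have -> : a ^+ 2 = 1 - b ^+ 2 by rewrite -hs; ring.
have -> : c ^+ 2 = 1 - d ^+ 2 by rewrite -ht; ring.
ring.
Qed.

Lemma Ssin_gt0 k : (k < npts L)%N -> 0 < Ssin R L k.
Proof.
elim: k => [|k IHk] k_lt; first by rewrite /Ssin big_geq.
rewrite SsinS mulr_gt0 ?IHk 1?ltnW // mulr_gt0 //.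
by apply: sin_pi_gt0; lia.
Qed.

(** Passing from (m, n+1) to (m+1, n) trades the chord of n+1 for that of m+1.
    These are equal by reflection, since m + (n+1) = 4L says that m+1 and n+1
    add up to N. *)
Lemma Ssin_mirror m n : (m + n = 4 * L)%N -> Ssin R L m * Ssin R L n = Ssin R L (4 * L).
Proof.
elim: n m => [|n IHn] m emn.
  by rewrite -emn addn0 [Ssin _ _ 0]/Ssin big_geq // mulr1.
rewrite -(IHn m.+1) ?addSnnS // !SsinS -(chord_reflect m.+1).
rewrite (_ : _ - _ = n.+1 :> int); first by rewrite mulrA mulrAC.
by rewrite /npts; lia.
Qed.

(** The indices m and n are 2L+k and 2L-k. Passing from d to d+1 brings the
    chords of m+d+1 and n+d+1, which by reflection are those of (2L-d)-k and
    (2L-d)+k: their product is the next factor of [cosprod]. *)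
Lemma Ssin_cosprod d m n : (m + n = 4 * L)%N ->
  Ssin R L (m + d) * Ssin R L (n + d) =
  Ssin R L (4 * L) * cosprod R L d (m%:Z - (2 * L)%:Z).
Proof.
move=> emn; elim: d => [|d IHd].
  by rewrite !addn0 Ssin_mirror // /cosprod big_ord0 mulr1.
rewrite !addnS !SsinS mulrACA IHd /cosprod big_ord_recr /= -chordM.
rewrite -(chord_reflect (m + d).+1) -(chord_reflect (n + d).+1).
rewrite -[LHS]mulrA; congr (_ * (_ * (chord _ * chord _))); rewrite /npts; lia.
Qed.

End SineProducts.

(** * Transforms of band-limited vectors *)

Section Vectors.
Variables (R : realType) (L : nat).
Implicit Types (f g : 'cV[R[i]]_(npts L)) (k j : 'I_(npts L)) (a b d m : nat).
Local Notation omega := (omega R L).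

(** The exponent of X is the position, that is, the index shifted by 2L. *)
Definition gpoly f : {poly R[i]} := rVpoly f^T.

Lemma coef_gpoly f k : (gpoly f)`_k = f k 0.
Proof. by rewrite coef_rVpoly_ord mxE. Qed.

Lemma gpoly_inj : injective gpoly.
Proof. by move=> f g efg; apply/colP=> k; rewrite -!coef_gpoly efg. Qed.

Lemma horner_gpoly f (z : R[i]) : (gpoly f).[z] = \sum_k f k 0 * z ^+ k.
Proof.
rewrite (@horner_coef_wide _ (npts L)); last exact: size_poly.
by apply: eq_bigr => k _; rewrite coef_gpoly.
Qed.

Definition band a f := forall k, (a < absz (ctr k))%N -> f k 0 = 0.

Lemma band_lo a f i : band a f -> (i < 2 * L - a)%N -> (gpoly f)`_i = 0.
Proof.
move=> f_a lt_i; have lt_iN : (i < npts L)%N by rewrite /npts; lia.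
by rewrite (coef_gpoly f (Ordinal lt_iN)) f_a // /ctr /=; lia.
Qed.

Lemma band_hi a f i : band a f -> (2 * L + a < i)%N -> (gpoly f)`_i = 0.
Proof.
move=> f_a lt_i; have [lt_iN|le_Ni] := ltnP i (npts L).
  by rewrite (coef_gpoly f (Ordinal lt_iN)) f_a // /ctr /=; lia.
by rewrite nth_default // (leq_trans (size_poly _ _)).
Qed.

Definition nu : R[i] := ((Num.sqrt (npts L)%:R)^-1)%:C.

Lemma nu_neq0 : nu != 0.
Proof.
rewrite fmorph_eq0 invr_eq0 gt_eqF // sqrtr_gt0 ltr0n //.
Qed.

Lemma dft_sum f j :
  dft f j 0 = nu * \sum_k omega ^ (- (ctr k * ctr j)) * f k 0.
Proof.
rewrite mxE; congr (_ * _); apply: eq_bigr => k _.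
by rewrite -expi_ang angN.
Qed.

Lemma dft_horner f j : dft f j 0 =
  nu * (omega ^ ((2 * L)%:Z * ctr j) * (gpoly f).[omega ^ (- ctr j)]).
Proof.
rewrite dft_sum horner_gpoly; congr (_ * _); rewrite big_distrr; apply: eq_bigr => k _ /=.
rewrite exprnP exprz_exp [RHS]mulrCA -omegaD [LHS]mulrC; congr (_ * omega ^ _).
by rewrite /ctr; ring.
Qed.

Lemma dft_parity f (s : R[i]) : (forall k, f k 0 = s * f (rev_ord k) 0) ->
  forall j, dft f j 0 = s * dft f (rev_ord j) 0.
Proof.
move=> f_s j; rewrite !dft_sum mulrCA; congr (_ * _).
rewrite (reindex_inj rev_ord_inj) big_distrr; apply: eq_bigr => k _ /=.
by rewrite f_s rev_ordK !ctr_rev_ord mulrCA mulrN mulNr.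
Qed.

(** A trigonometric polynomial of degree d has no frequency beyond d. The
    frequencies i - d - j that occur in the double sum are nonzero and less than
    N in absolute value, so no aliasing takes place. *)
Lemma band_dft f (p : {poly R[i]}) d : (size p <= (2 * d).+1)%N ->
    (forall k, f k 0 = omega ^ (- (ctr k * d%:Z)) * p.[omega ^ ctr k]) ->
  band d (dft f).
Proof.
move=> p_size fE j lt_dj; rewrite dft_sum.
have -> : \sum_k omega ^ (- (ctr k * ctr j)) * f k 0 = \sum_(i < (2 * d).+1) p`_i *
    \sum_(k < npts L) omega ^ ((i%:Z - d%:Z - ctr j) * ctr k); last first.
  rewrite big1 ?mulr0 // => i _; have := ltn_ord i; have := ltn_ord j.
  move: lt_dj; rewrite /ctr => lt_dj lt_j lt_i; rewrite sum_omega ?mulr0 //.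
    by lia.
  by have eN : npts L = (4 * L).+1 by []; lia.
under [RHS]eq_bigr do rewrite big_distrr.
rewrite exchange_big /=; apply: eq_bigr => k _ /=.
rewrite fE (horner_coef_wide _ p_size) !big_distrr; apply: eq_bigr => i _ /=.
rewrite [RHS]mulrC exprnP exprz_exp !mulrA [LHS]mulrAC -!omegaD.
by congr (omega ^ _ * _); ring.
Qed.

(** The root w^m is w^(-j) for j = -m or j = N - m, whichever is an index. *)
Lemma gpoly_root a f m : (a <= 2 * L)%N -> band (2 * L - a) (dft f) ->
  (2 * L - a < m <= 2 * L + a)%N -> (gpoly f).[omega ^+ m] = 0.
Proof.
move=> le_a f_band m_bd.
have [j [e lt_j]] : exists j, omega ^ (- ctr j) = omega ^+ m /\
    (2 * L - a < absz (ctr j))%N.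
  have [le_m|gt_m] := leqP m (2 * L).
    have lt_j : (2 * L - m < npts L)%N by rewrite /npts; lia.
    exists (Ordinal lt_j); rewrite /ctr /= exprnP; split; last lia.
    by congr (omega ^ _); lia.
  have lt_j : (npts L - m + 2 * L < npts L)%N by rewrite /npts; lia.
  exists (Ordinal lt_j); rewrite /ctr /= exprnP; split; last by rewrite /npts; lia.
  rewrite -[LHS]mulr1 -(omega_npts R L) -omegaD.
  by congr (omega ^ _); rewrite /npts; lia.
have := f_band j lt_j; rewrite dft_horner e => /eqP.
rewrite !mulf_eq0 (negPf nu_neq0) /= => /orP[|/eqP //].
by rewrite (negPf (expfz_neq0 _ (omega_neq0 R L))).
Qed.

Lemma extremal_even_gpoly a f : (a <= 2 * L)%N -> band a f ->
    band (2 * L - a) (dft f) ->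
  gpoly f = (gpoly f)`_(2 * L + a) *: ('X^(2 * L - a) * cospoly R L a).
Proof.
move=> le_a f_a Ff_a; apply: extremal_even_poly => // [i|i|m].
- exact: band_lo.
- exact: band_hi.
exact: gpoly_root.
Qed.

(** The powers of w coming from X^(2L-a), from [horner_cospoly] and from
    [dft_horner] cancel. *)
Lemma extremal_even_dft a f j : (a <= 2 * L)%N -> band a f ->
    band (2 * L - a) (dft f) ->
  dft f j 0 = nu * ((gpoly f)`_(2 * L + a) * (cosprod R L a (ctr j))%:C).
Proof.
move=> le_a f_a Ff_a; rewrite dft_horner; congr (_ * _).
rewrite {1}(extremal_even_gpoly le_a f_a Ff_a) hornerZ hornerM hornerXn horner_cospoly.
rewrite exprnP exprz_exp cosprodN [LHS]mulrCA; congr (_ * _).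
rewrite mulrA -omegaD mulrA -omegaD -[RHS]mul1r -(expr0z omega).
by congr (omega ^ _ * _); rewrite -subzn //; ring.
Qed.

Lemma extremal_even_inj a f g : (a <= 2 * L)%N -> band a f -> band a g ->
    band (2 * L - a) (dft f) -> band (2 * L - a) (dft g) ->
  (gpoly f)`_(2 * L + a) = (gpoly g)`_(2 * L + a) -> f = g.
Proof.
move=> le_a f_a g_a Ff_a Fg_a fg_a; apply: gpoly_inj.
by rewrite (extremal_even_gpoly le_a f_a Ff_a) fg_a -extremal_even_gpoly.
Qed.

Definition odd_cvec f := forall k, f k 0 = - f (rev_ord k) 0.

Lemma extremal_odd_gpoly e f : (e < 2 * L)%N -> odd_cvec f ->
    band e.+1 f -> band (2 * L - e) (dft f) ->
  gpoly f = (gpoly f)`_(2 * L + e.+1) *: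
    ('X^(2 * L - e.+1) * (('X^2 - 1) * cospoly R L e)).
Proof.
move=> lt_e f_odd f_e Ff_e; apply: extremal_odd_poly => // [i|i|||m].
- exact: band_lo.
- exact: band_hi.
- have lt_k : (2 * L - e.+1 < npts L)%N by rewrite /npts; lia.
  rewrite (coef_gpoly f (Ordinal lt_k)) f_odd -coef_gpoly.
  by congr (- (gpoly f)`_ _); rewrite /= /npts; lia.
- have: (gpoly f).[1] = - (gpoly f).[1].
    rewrite horner_gpoly {1}(reindex_inj rev_ord_inj) -sumrN.
    apply: eq_bigr => k _.
    by rewrite !expr1n !mulr1 f_odd rev_ordK.
  by move/eqP; rewrite -addr_eq0 -mulr2n mulrn_eq0 => /eqP.
by apply: gpoly_root => //; lia.
Qed.

(** As in the even case, except that X^2 - 1 leaves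
    w^-j - w^j = -2i sin(2 pi j/N). *)
Lemma extremal_odd_dft e f j : (e < 2 * L)%N -> odd_cvec f ->
    band e.+1 f -> band (2 * L - e) (dft f) ->
  dft f j 0 = nu * ((gpoly f)`_(2 * L + e.+1) *
    (- 'i * (2 * sin (ang R L (ctr j)) * cosprod R L e (ctr j))%:C)).
Proof.
move=> lt_e f_odd f_e Ff_e; rewrite dft_horner; congr (_ * _).
rewrite {1}(extremal_odd_gpoly lt_e f_odd f_e Ff_e) hornerZ !hornerM horner_cospoly.
rewrite cosprodN [LHS]mulrCA; congr (_ * _).
have -> : - 'i * (2 * sin (ang R L (ctr j)) * cosprod R L e (ctr j))%:C =
    (omega ^ (- ctr j) - omega ^ ctr j) * (cosprod R L e (ctr j))%:C.
  rewrite rmorphM mulrA; congr (_ * _).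
  rewrite !omegaE angN cosN sinN; apply/eqP; rewrite eq_complex /=.
  by apply/andP; split; apply/eqP; ring.
have -> : ('X^2 - 1 : {poly R[i]}).[omega ^ - ctr j] = omega ^ (- ctr j * 2) - 1.
  by rewrite !hornerE exprnP exprz_exp.
rewrite hornerXn exprnP exprz_exp [LHS]mulrA -omegaD [LHS]mulrA [LHS]mulrA; congr (_ * _).
rewrite mulrBr mulr1 mulrBl -!omegaD.
by congr (omega ^ _ - omega ^ _); rewrite -subzn //; ring.
Qed.

Lemma extremal_odd_inj e f g : (e < 2 * L)%N -> odd_cvec f -> odd_cvec g ->
    band e.+1 f -> band e.+1 g ->
    band (2 * L - e) (dft f) -> band (2 * L - e) (dft g) ->
  (gpoly f)`_(2 * L + e.+1) = (gpoly g)`_(2 * L + e.+1) -> f = g.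
Proof.
move=> lt_e f_odd g_odd f_e g_e Ff_e Fg_e fg_e; apply: gpoly_inj.
by rewrite (extremal_odd_gpoly lt_e f_odd f_e Ff_e) fg_e -extremal_odd_gpoly.
Qed.

Lemma ell_band a f : (a <= 2 * L)%N -> band a f ->
    (gpoly f)`_(2 * L - a) != 0 -> (gpoly f)`_(2 * L + a) != 0 ->
  ell f = (2 * a).+1.
Proof.
move=> le_a f_a f_lo f_hi; rewrite /ell add1n; congr _.+1.
have lt_lo : (2 * L - a < npts L)%N by rewrite /npts; lia.
have lt_hi : (2 * L + a < npts L)%N by rewrite /npts; lia.
have supp_bd k : k \in supp f -> (2 * L - a <= k <= 2 * L + a)%N.
  rewrite inE; apply: contraR => k_out; rewrite f_a // /ctr; lia.
apply/eqP; rewrite eqn_leq; apply/andP; split.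
  apply/bigmax_leqP => i /supp_bd i_bd; apply/bigmax_leqP => j /supp_bd j_bd.
  lia.
apply: (@bigop.bigmax_sup _ (Ordinal lt_hi)); first by rewrite inE -coef_gpoly.
apply: (@bigop.bigmax_sup _ (Ordinal lt_lo)); first by rewrite inE -coef_gpoly.
by rewrite /=; lia.
Qed.

(** A vector with symmetric support is measured by its largest index a alone.
    The zero vector is included, with a = 0, in agreement with its length 1;
    this lets a transform be measured before it is known to be nonzero. *)
Lemma ell_sym f (s : R[i]) : s != 0 ->
    (forall k, f k 0 = s * f (rev_ord k) 0) ->
  exists a, [/\ (a <= 2 * L)%N, ell f = (2 * a).+1, band a f &
    f != 0 -> (gpoly f)`_(2 * L + a) != 0].
Proof.
move=> s0 f_s; have [f0|] := eqVneq f 0.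
  exists 0; split=> //; first last.
    by move=> k _; rewrite f0 mxE.
  rewrite /ell big1 // => i; by rewrite inE f0 mxE eqxx.
move=> fn0; pose a := \max_(k in supp f) absz (ctr k).
have [k0 k0f] : {k | k \in supp f}.
  apply/sigW; apply/existsP; apply: contraR fn0; rewrite negb_exists => /forallP f0.
  by apply/eqP/colP=> k; have := f0 k; rewrite inE negbK mxE => /eqP.
have f_a : band a f.
  move=> k; apply: contraTeq => fk; rewrite -leqNgt.
  by apply: (@bigop.bigmax_sup _ k); rewrite ?inE.
have supp_gt0 : (0 < #|supp f|)%N by apply/card_gt0P; exists k0.
have [k1 k1f ak1] := eq_bigmax_cond (fun k => absz (ctr k)) supp_gt0.
have {}ak1 : a = absz (ctr k1) by [].
have eN : npts L = (4 * L).+1 by [].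
clearbody a.
have le_a : (a <= 2 * L)%N.
  rewrite ak1 /ctr; have := ltn_ord k1; lia.
have f_hilo : (gpoly f)`_(2 * L + a) != 0 /\ (gpoly f)`_(2 * L - a) != 0.
  have fk1 : f k1 0 != 0 by rewrite inE in k1f.
  have frk1 : f (rev_ord k1) 0 != 0.
    by apply: contraNneq fk1 => e; rewrite f_s e mulr0.
  have := coef_gpoly f k1; have := coef_gpoly f (rev_ord k1).
  have [k1_ge|k1_lt] := leqP (2 * L) k1.
    have -> : rev_ord k1 = (2 * L - a)%N :> nat by rewrite ak1 /ctr /=; lia.
    have -> : k1 = (2 * L + a)%N :> nat by rewrite ak1 /ctr /=; lia.
    by move=> -> ->.
  have -> : rev_ord k1 = (2 * L + a)%N :> nat by rewrite ak1 /ctr /=; lia.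
  have -> : k1 = (2 * L - a)%N :> nat by rewrite ak1 /ctr /=; lia.
  by move=> -> ->.
by case: f_hilo => hi lo; exists a; split=> //; apply: ell_band.
Qed.

End Vectors.

(** * The vectors u_n and v_n *)

Section Extremizers.
Variables (R : realType) (L : nat).
Implicit Types (k j : 'I_(npts L)) (d e : nat).
Local Notation nu := (nu R L).
Local Notation ang := (ang R L).
Local Notation omega := (omega R L).

(** The shifted parameter d = L + n is the degree of u_n as a trigonometric
    polynomial; the largest index in its support is 2L - d = L - n. *)
Definition uv d : 'cV[R]_(npts L) := uvec R L (d%:Z - L%:Z).
Definition vv d : 'cV[R]_(npts L) := vvec R L (d%:Z - L%:Z).

Lemma uv_Ssin d k : uv d k 0 = Ssin R L (k + d) * Ssin R L (4 * L - k + d).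
Proof.
have eN : npts L = (4 * L).+1 by []; have lt_k := ltn_ord k.
by rewrite mxE; congr (Ssin R L _ * Ssin R L _); rewrite /ctr; lia.
Qed.

Lemma vv_uv d k : vv d k 0 = sin (ang (ctr k)) * uv d k 0.
Proof. by rewrite !mxE mulrA. Qed.

Lemma uv_cosprod d k : uv d k 0 = Ssin R L (4 * L) * cosprod R L d (ctr k).
Proof.
have eN : npts L = (4 * L).+1 by []; have lt_k := ltn_ord k.
rewrite uv_Ssin Ssin_cosprod //; lia.
Qed.

Lemma cplxE (u : 'cV[R]_(npts L)) k : cplx u k 0 = (u k 0)%:C.
Proof. by rewrite mxE. Qed.

Lemma uv_band d : (d <= 2 * L)%N -> band (2 * L - d) (cplx (uv d)).
Proof.
move=> le_d k lt_k; rewrite cplxE uv_cosprod cosprod_eq0 ?mulr0 //.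
have eN : npts L = (4 * L).+1 by []; have := ltn_ord k.
by move: lt_k; rewrite /ctr; lia.
Qed.

Lemma vv_band d : (d <= 2 * L)%N -> band (2 * L - d) (cplx (vv d)).
Proof.
move=> le_d k /(uv_band le_d); rewrite !cplxE vv_uv rmorphM /= => ->.
by rewrite mulr0.
Qed.

Lemma uv_even d : even_vec (uv d).
Proof. by move=> k; rewrite !uv_cosprod ctr_rev_ord cosprodN. Qed.

Lemma vv_odd d : odd_vec (vv d).
Proof.
by move=> k; rewrite !vv_uv -uv_even ctr_rev_ord angN sinN mulNr opprK.
Qed.

Lemma uv_top d k : (d <= 2 * L)%N -> k = (2 * L + (2 * L - d))%N :> nat ->
  uv d k 0 = Ssin R L (4 * L) * Ssin R L (2 * d).
Proof.
by move=> le_d ek; rewrite uv_Ssin ek; congr (Ssin R L _ * Ssin R L _); lia.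
Qed.

Lemma chord_double x : chord R L (2 * x) = 2 * sin (ang x).
Proof. by rewrite /chord ang_half; congr (2 * sin _); rewrite rmorphM /=; ring. Qed.

(** The sine 2 sin(2 pi (2L-d)/N) is the chord of 4L-2d, hence of
    N - (4L-2d) = 2d+1: it is the factor that completes S(2d) to S(2d+1). *)
Lemma vv_top d k : (d < 2 * L)%N -> k = (2 * L + (2 * L - d))%N :> nat ->
  2 * vv d k 0 = Ssin R L (4 * L) * Ssin R L (2 * d).+1.
Proof.
move=> lt_d ek; rewrite vv_uv (uv_top _ ek) 1?ltnW // SsinS -chord_reflect.
rewrite (_ : _ - _ = 2 * ctr k); last by rewrite /ctr ek /npts; lia.
by rewrite chord_double; ring.
Qed.

Lemma dft_uv_band d : band d (dft (cplx (uv d))).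
Proof.
apply: (@band_dft _ _ _ ((Ssin R L (4 * L))%:C *: cospoly R L d)).
  by rewrite (leq_trans (size_scale_leq _ _)) // size_cospoly.
move=> k; rewrite hornerZ horner_cospoly [RHS]mulrCA [X in _ * X]mulrA.
rewrite -omegaD addNr expr0z mul1r.
by rewrite cplxE uv_cosprod rmorphM.
Qed.

Lemma omega_sin x : (sin (ang x))%:C = (2 * 'i)^-1 * (omega ^ x - omega ^ (- x)).
Proof.
have i2 : 2 * 'i != 0 :> R[i] by rewrite mulf_neq0 ?pnatr_eq0 ?neq0Ci.
apply: (mulfI i2); rewrite mulVKf // !omegaE angN cosN sinN.
apply/eqP; rewrite eq_complex /=; apply/andP; split; apply/eqP; ring.
Qed.

Lemma dft_vv_band d : band d.+1 (dft (cplx (vv d))).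
Proof.
apply: (@band_dft _ _ _
  (((2 * 'i)^-1 * (Ssin R L (4 * L))%:C) *: (('X^2 - 1) * cospoly R L d))).
  apply: leq_trans (size_scale_leq _ _) _; apply: leq_trans (size_polyMleq _ _) _.
  rewrite size_cospoly size_XnsubC //; lia.
move=> k; rewrite hornerZ hornerM horner_cospoly.
have -> : ('X^2 - 1 : {poly R[i]}).[omega ^ ctr k] =
    omega ^ ctr k * (omega ^ ctr k - omega ^ (- ctr k)).
  by rewrite !hornerE expr2 mulrBr -!omegaD subrr expr0z.
rewrite cplxE vv_uv uv_cosprod !rmorphM /= omega_sin.
have -> : omega ^ (- (ctr k * d.+1%:Z)) = (omega ^ ctr k * omega ^ (ctr k * d%:Z))^-1.
  by rewrite -omegaD invr_expz intS mulrDr mulr1.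
rewrite -(invr_expz _ (ctr k)).
have := expfz_neq0 (ctr k) (omega_neq0 R L).
have := expfz_neq0 (ctr k * d%:Z) (omega_neq0 R L).
move: (omega ^ _) (omega ^ _) => z w z0 w0.
have i0 : 'i != 0 :> R[i] by rewrite neq0Ci.
by field; rewrite z0 w0 i0.
Qed.

(** The transform is computed from the entry S(4L) S(2d) at the largest index
    of the support; the factor S(4L) turns [cosprod (2L-d)] into [uv (2L-d)]. *)
Lemma dft_uv d : (d <= 2 * L)%N ->
  dft (cplx (uv d)) =
  ((Num.sqrt (npts L)%:R)^-1 * Ssin R L (2 * d))%:C *: cplx (uv (2 * L - d)).
Proof.
move=> le_d; apply/colP=> j; rewrite [RHS]mxE cplxE uv_cosprod.
have lt_k : (2 * L + (2 * L - d) < npts L)%N by rewrite /npts; lia.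
rewrite (@extremal_even_dft _ _ (2 * L - d)) ?leq_subr ?subKn //; last 2 first.
- exact: uv_band.
- exact: dft_uv_band.
rewrite (coef_gpoly _ (Ordinal lt_k)) cplxE uv_top // /nu !rmorphM /=.
ring.
Qed.

Lemma cplx_odd (v : 'cV[R]_(npts L)) : odd_vec v -> odd_cvec (cplx v).
Proof. by move=> v_odd k; rewrite !cplxE v_odd rmorphN. Qed.

Lemma dft_vv d : (d < 2 * L)%N ->
  dft (cplx (vv d)) =
  (- 'i * ((Num.sqrt (npts L)%:R)^-1 * Ssin R L (2 * d).+1)%:C)
    *: cplx (vv (2 * L - d.+1)).
Proof.
move=> lt_d; apply/colP=> j; rewrite [RHS]mxE cplxE vv_uv uv_cosprod.
have lt_k : (2 * L + (2 * L - d) < npts L)%N by rewrite /npts; lia.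
(* [vv d] has the largest index e + 1 for e = 2L - (d+1). *)
have ed : (2 * L - d)%N = (2 * L - d.+1).+1 by lia.
rewrite (@extremal_odd_dft _ _ (2 * L - d.+1)); last 4 first.
- by lia.
- exact/cplx_odd/vv_odd.
- by rewrite -ed; apply: vv_band; apply: ltnW.
- by rewrite subKn //; apply: dft_vv_band.
rewrite -ed (coef_gpoly _ (Ordinal lt_k)) cplxE.
have := @vv_top d (Ordinal lt_k) lt_d erefl; move: (vv d _ 0) => t ht.
transitivity (nu * (- 'i * (2 * t)%:C *
    (sin (ang (ctr j)) * cosprod R L (2 * L - d.+1) (ctr j))%:C)).
  by rewrite !rmorphM /=; ring.
by rewrite ht /nu !rmorphM /=; ring.
Qed.

End Extremizers.

(** * Linear independence *)

Section Independence.
Variables (F : fieldType) (p : nat).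

(** At the entry [pos m], f m is nonzero while every later vector vanishes, and
    so does their span. *)
Lemma free_triangular (f : nat -> 'cV[F]_p) (pos : nat -> 'I_p) (m n : nat) :
    (forall i, (m <= i < m + n)%N -> f i (pos i) 0 != 0) ->
    (forall i j, (m <= i < j)%N -> (j < m + n)%N -> f j (pos i) 0 = 0) ->
  free [seq f i | i <- iota m n].
Proof.
elim: n m => [|n IHn] m diag tri; first by rewrite /= nil_free.
rewrite /= free_cons IHn; first last.
- by move=> i j ij jn; apply: tri; lia.
- by move=> i mi; apply: diag; lia.
rewrite andbT; apply: contra (diag m _); last lia.
set s := [seq _ | _ <- _] => /(@coord_span _ _ _ (in_tuple s)) ->.
rewrite summxE big1 // => i _; rewrite mxE.
have lt_i : (i < n)%N by apply: leq_trans (ltn_ord i) _; rewrite size_map size_iota.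
rewrite /= (nth_map 0) ?size_iota // nth_iota // tri ?mulr0 //; lia.
Qed.

End Independence.

(** * Characterization of the extremal vectors *)

Section Characterization.
Variables (R : realType) (L : nat).
Implicit Types (f g : 'cV[R[i]]_(npts L)) (u v : 'cV[R]_(npts L)) (d e : nat).
Local Notation uv := (uv R L).
Local Notation vv := (vv R L).

Lemma band_le a b f : (a <= b)%N -> band a f -> band b f.
Proof. by move=> le_ab f_a k lt_k; apply: f_a; apply: leq_ltn_trans lt_k. Qed.

Lemma cplxZ (c : R) u : cplx (c *: u) = c%:C *: cplx u.
Proof. by apply/colP=> k; rewrite !mxE rmorphM. Qed.

Lemma cplx_inj : injective (@cplx R L).
Proof.
by move=> u v /colP euv; apply/colP=> k; have := euv k; rewrite !cplxE => /fmorph_inj.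
Qed.

Lemma cplx_eq0 u : (cplx u == 0) = (u == 0).
Proof.
apply/eqP/eqP=> [u0|->]; last by apply/colP=> k; rewrite !mxE.
by apply: cplx_inj; rewrite u0; apply/colP=> k; rewrite !mxE.
Qed.

Lemma dftZ (c : R[i]) f : dft (c *: f) = c *: dft f.
Proof.
apply/colP=> j; rewrite [RHS]mxE !dft_sum mulrCA; congr (_ * _).
by rewrite big_distrr; apply: eq_bigr => k _; rewrite mxE /= mulrCA.
Qed.

Lemma ellZ (c : R[i]) f : c != 0 -> ell (c *: f) = ell f.
Proof.
move=> c0; rewrite /ell (_ : supp (c *: f) = supp f) //.
by apply/setP=> k; rewrite !inE mxE mulf_eq0 negb_or c0.
Qed.

Lemma bandZ a (c : R[i]) f : band a f -> band a (c *: f).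
Proof. by move=> f_a k lt_k; rewrite mxE f_a ?mulr0. Qed.

Lemma lt_lo a : (2 * L - a < npts L)%N. Proof. rewrite /npts; lia. Qed.

Lemma lt_hi a : (a <= 2 * L)%N -> (2 * L + a < npts L)%N.
Proof. rewrite /npts; lia. Qed.

Lemma ell_band_sym a f (s : R[i]) : (a <= 2 * L)%N -> s != 0 ->
    (forall k, f k 0 = s * f (rev_ord k) 0) -> band a f ->
  (gpoly f)`_(2 * L + a) != 0 -> ell f = (2 * a).+1.
Proof.
move=> le_a s0 f_s f_a f_hi; apply: ell_band => //.
have := coef_gpoly f (Ordinal (lt_lo a)) => /= ->; rewrite f_s -coef_gpoly mulf_neq0 //.
by move: f_hi; congr (_`_ _ != 0); rewrite /= /npts; lia.
Qed.

Lemma cplx_even u : even_vec u ->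
  forall k, cplx u k 0 = 1 * cplx u (rev_ord k) 0.
Proof. by move=> u_even k; rewrite mul1r !cplxE u_even. Qed.

Lemma cplx_anti v : odd_vec v ->
  forall k, cplx v k 0 = -1 * cplx v (rev_ord k) 0.
Proof. by move=> v_odd k; rewrite mulN1r; apply: cplx_odd. Qed.

Lemma uv_top_neq0 d (k : 'I_(npts L)) : (d <= 2 * L)%N ->
  k = (2 * L + (2 * L - d))%N :> nat -> uv d k 0 != 0.
Proof.
move=> le_d ek; rewrite (uv_top R le_d ek) mulf_neq0 // gt_eqF ?Ssin_gt0 //.
by rewrite /npts; lia.
Qed.

Lemma ell_uv d : (d <= 2 * L)%N -> ell (cplx (uv d)) = (2 * (2 * L - d)).+1.
Proof.
move=> le_d; apply: (@ell_band_sym _ _ 1); rewrite ?leq_subr ?oner_eq0 //.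
- exact/cplx_even/uv_even.
- exact: uv_band.
by rewrite (coef_gpoly _ (Ordinal (lt_hi (leq_subr d _)))) cplxE fmorph_eq0 uv_top_neq0.
Qed.

Lemma vv_top_neq0 d (k : 'I_(npts L)) : (d < 2 * L)%N ->
  k = (2 * L + (2 * L - d))%N :> nat -> vv d k 0 != 0.
Proof.
move=> lt_d ek; have := vv_top R lt_d ek => e; apply/eqP=> v0; move/eqP: e.
by rewrite v0 mulr0 eq_sym mulf_eq0 !gt_eqF ?Ssin_gt0 // /npts; lia.
Qed.

Lemma ell_vv d : (d < 2 * L)%N -> ell (cplx (vv d)) = (2 * (2 * L - d)).+1.
Proof.
move=> lt_d; apply: (@ell_band_sym _ _ (-1)); rewrite ?leq_subr ?oppr_eq0 ?oner_eq0 //.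
- exact/cplx_anti/vv_odd.
- exact/vv_band/ltnW.
by rewrite (coef_gpoly _ (Ordinal (lt_hi (leq_subr d _)))) cplxE fmorph_eq0 vv_top_neq0.
Qed.

(** The vector u is compared with the multiple of [uv (2L-a)] that has the same
    entry at the largest index a of the support of u. *)
Lemma even_extremizers u :
  [/\ u != 0, even_vec u & (ell (cplx u) + ell (dft (cplx u)) = npts L + 1)%N] <->
  exists d (c : R), [/\ (d <= 2 * L)%N, c != 0 & u = c *: uv d].
Proof.
split=> [[u0 u_even ell_u]|[d [c [le_d c0 ->]]]].
  have Cu_even := cplx_even u_even.
  have [a [le_a ell_a u_a u_hi]] := ell_sym (oner_neq0 _) Cu_even.
  have [b [le_b ell_b Fu_b _]] := ell_sym (oner_neq0 _) (dft_parity Cu_even).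
  have ab : b = (2 * L - a)%N.
    by move: ell_u; rewrite ell_a ell_b /npts; lia.
  have Cu0 : cplx u != 0 by rewrite cplx_eq0.
  set k := Ordinal (lt_hi le_a).
  have uk0 : u k 0 != 0 by have := u_hi Cu0; rewrite (coef_gpoly _ k) cplxE fmorph_eq0.
  have ad : a = (2 * L - (2 * L - a))%N by rewrite subKn.
  have vk0 : uv (2 * L - a) k 0 != 0.
    by apply: uv_top_neq0; rewrite ?leq_subr //= -ad.
  exists (2 * L - a)%N, (u k 0 / uv (2 * L - a) k 0); split; first exact: leq_subr.
    by rewrite mulf_neq0 ?invr_eq0.
  apply: cplx_inj; rewrite cplxZ; apply: (extremal_even_inj le_a) => //.
  - by apply: bandZ; rewrite {1}ad; apply: uv_band; apply: leq_subr.
  - by rewrite -ab.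
  - by rewrite dftZ; apply: bandZ; apply: dft_uv_band.
  by rewrite !(coef_gpoly _ k) [in RHS]mxE !cplxE -rmorphM divfK.
have Cc0 : c%:C != 0 by rewrite fmorph_eq0.
split.
- set k := Ordinal (lt_hi (leq_subr d (2 * L))).
  have := @uv_top_neq0 d k le_d erefl; apply: contraNneq => /colP/(_ k)/eqP.
  by rewrite [X in X == _]mxE [X in _ == X]mxE mulf_eq0 (negPf c0).
- by move=> k; rewrite [LHS]mxE [in RHS]mxE uv_even.
rewrite cplxZ dftZ !ellZ // dft_uv // ellZ ?ell_uv ?leq_subr //.
  by rewrite /npts; lia.
rewrite fmorph_eq0 mulf_neq0 ?invr_eq0 ?gt_eqF ?sqrtr_gt0 ?ltr0n ?Ssin_gt0 //.
by rewrite /npts; lia.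
Qed.

(** Here a > 0 because v(0) = 0. The inequality only bounds the band of the
    transform by 2L+1-a, which is what uniqueness requires. *)
Lemma odd_extremizers v :
  [/\ v != 0, odd_vec v & (ell (cplx v) + ell (dft (cplx v)) <= npts L + 3)%N] <->
  exists d (c : R), [/\ (d < 2 * L)%N, c != 0 & v = c *: vv d].
Proof.
split=> [[v0 v_odd ell_v]|[d [c [lt_d c0 ->]]]].
  have Cv_anti := cplx_anti v_odd.
  have N10 : -1 != 0 :> R[i] by rewrite oppr_eq0 oner_eq0.
  have [a [le_a ell_a v_a v_hi]] := ell_sym N10 Cv_anti.
  have [b [le_b ell_b Fv_b _]] := ell_sym N10 (dft_parity Cv_anti).
  have Cv0 : cplx v != 0 by rewrite cplx_eq0.
  set k := Ordinal (lt_hi le_a).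
  have vk0 : v k 0 != 0 by have := v_hi Cv0; rewrite (coef_gpoly _ k) cplxE fmorph_eq0.
  have a_gt0 : (0 < a)%N.
    rewrite lt0n; apply: contraNneq vk0 => a0; apply/eqP.
    have ek : rev_ord k = k by apply: val_inj; rewrite /= a0 /npts; lia.
    have /eqP := v_odd k; rewrite ek -addr_eq0 -mulr2n mulrn_eq0 => /eqP //.
  have ab : (b <= 2 * L - a.-1)%N.
    by move: ell_v; rewrite ell_a ell_b /npts; lia.
  have ad : a = (2 * L - (2 * L - a))%N by rewrite subKn.
  have ea : a = a.-1.+1 by lia.
  have lt_d : (2 * L - a < 2 * L)%N by lia.
  have wk0 : vv (2 * L - a) k 0 != 0 by apply: vv_top_neq0; rewrite //= -ad.
  exists (2 * L - a)%N, (v k 0 / vv (2 * L - a) k 0); split=> //.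
    by rewrite mulf_neq0 ?invr_eq0.
  have lt_e : (a.-1 < 2 * L)%N by lia.
  apply: cplx_inj; rewrite cplxZ; apply: (extremal_odd_inj lt_e).
  - by move=> j; rewrite Cv_anti mulN1r.
  - move=> j; have := cplx_odd (@vv_odd R L (2 * L - a)) j.
    by rewrite !mxE => ->; rewrite mulrN.
  - by rewrite -ea.
  - by rewrite -ea; apply: bandZ; rewrite {1}ad; apply: vv_band; apply: leq_subr.
  - exact: band_le Fv_b.
  - rewrite dftZ; apply: bandZ; apply: (@band_le (2 * L - a).+1); first lia.
    exact: dft_vv_band.
  by rewrite -ea !(coef_gpoly _ k) [in RHS]mxE !cplxE -rmorphM divfK.
have Cc0 : c%:C != 0 by rewrite fmorph_eq0.
split.
- set k := Ordinal (lt_hi (leq_subr d (2 * L))).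
  have := @vv_top_neq0 d k lt_d erefl; apply: contraNneq => /colP/(_ k)/eqP.
  by rewrite [X in X == _]mxE [X in _ == X]mxE mulf_eq0 (negPf c0).
- by move=> k; rewrite [LHS]mxE [in RHS]mxE vv_odd mulrN.
rewrite cplxZ dftZ !ellZ // dft_vv // ellZ ?ell_vv //; try lia.
  by rewrite /npts; lia.
rewrite mulf_neq0 ?oppr_eq0 ?neq0Ci //.
rewrite fmorph_eq0 mulf_neq0 ?invr_eq0 ?gt_eqF ?sqrtr_gt0 ?ltr0n ?Ssin_gt0 //.
by rewrite /npts; lia.
Qed.

Lemma band_cplx a u (k : 'I_(npts L)) :
  band a (cplx u) -> (a < absz (ctr k))%N -> u k 0 = 0.
Proof.
by move=> u_a /u_a/eqP; rewrite cplxE fmorph_eq0 => /eqP.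
Qed.

Lemma free_uv n : (n <= (2 * L).+1)%N -> free [seq uv d | d <- iota 0 n].
Proof.
move=> le_n; apply: (@free_triangular _ _ _ (fun d => inord (4 * L - d))).
  move=> d d_bd; have le_d : (d <= 2 * L)%N by lia.
  by apply: uv_top_neq0; rewrite ?inordK; lia.
move=> d e lt_de lt_e; have le_e : (e <= 2 * L)%N by lia.
by apply: (band_cplx (uv_band R le_e)); rewrite /ctr inordK; lia.
Qed.

Lemma free_vv n : (n <= 2 * L)%N -> free [seq vv d | d <- iota 0 n].
Proof.
move=> le_n; apply: (@free_triangular _ _ _ (fun d => inord (4 * L - d))).
  by move=> d d_bd; apply: vv_top_neq0; rewrite ?inordK; lia.
move=> d e lt_de lt_e; have le_e : (e <= 2 * L)%N by lia.
by apply: (band_cplx (vv_band R le_e)); rewrite /ctr inordK; lia.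
Qed.

End Characterization.

Theorem theorem2 (R : realType) (L : nat) (hL : (1 <= L)%N) :
  ([/\ forall u : 'cV[R]_(npts L),
         [/\ u != 0, even_vec u & (ell (cplx u) + ell (dft (cplx u)) = npts L + 1)%N]
         <-> (exists (n : int) (c : R),
                [/\ - L%:Z <= n <= L%:Z, c != 0 & u = c *: uvec R L n]),
       free [seq uvec R L (m%:Z - L%:Z) | m <- iota 0 (2 * L + 1)]
     & forall n : int, - L%:Z <= n <= L%:Z ->
         dft (cplx (uvec R L n)) =
         ((Num.sqrt (npts L)%:R)^-1 * Ssin R L (absz ((2 * L)%:Z + 2 * n)%R))%:C
           *: cplx (uvec R L (- n))])
  /\
  ([/\ forall v : 'cV[R]_(npts L),
         [/\ v != 0, odd_vec v & (ell (cplx v) + ell (dft (cplx v)) <= npts L + 3)%N]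
         <-> (exists (n : int) (c : R),
                [/\ - L%:Z <= n <= L%:Z - 1, c != 0 & v = c *: vvec R L n]),
       free [seq vvec R L (m%:Z - L%:Z) | m <- iota 0 (2 * L)]
     & forall n : int, - L%:Z <= n <= L%:Z - 1 ->
         dft (cplx (vvec R L n)) =
         (- 'i%C * ((Num.sqrt (npts L)%:R)^-1 * Ssin R L (absz ((2 * L)%:Z + 2 * n + 1)%R))%:C)
           *: cplx (vvec R L (- n - 1))]).
Proof.
split; split.
- move=> u; apply: (iff_trans (even_extremizers u)); split.
    by case=> d [c [le_d c0 ->]]; exists (d%:Z - L%:Z), c; split=> //; lia.
  case=> n [c [n_bd c0 ->]]; exists (absz (n + L%:Z)), c; split=> //; first lia.
  by congr (_ *: uvec R L _); lia.
- by apply: free_uv; rewrite addn1.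
- move=> n n_bd.
  have [d [le_d ->]] : exists d, (d <= 2 * L)%N /\ n = d%:Z - L%:Z.
    by exists (absz (n + L%:Z)); lia.
  rewrite [LHS]dft_uv //; congr ((_ * Ssin R L _)%:C *: cplx (uvec R L _)); lia.
- move=> v; apply: (iff_trans (odd_extremizers v)); split.
    by case=> d [c [le_d c0 ->]]; exists (d%:Z - L%:Z), c; split=> //; lia.
  case=> n [c [n_bd c0 ->]]; exists (absz (n + L%:Z)), c; split=> //; first lia.
  by congr (_ *: vvec R L _); lia.
- exact: free_vv.
move=> n n_bd.
have [d [lt_d ->]] : exists d, (d < 2 * L)%N /\ n = d%:Z - L%:Z.
  by exists (absz (n + L%:Z)); lia.
rewrite [LHS]dft_vv //; congr ((_ * (_ * Ssin R L _)%:C) *: cplx (vvec R L _)); lia.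
Qed.
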